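(* There exists a family of traces $t_n:\widetilde{TL}_n(1)\to A_1$ (i.e. $A_1$-linear maps with $t_n(uv)=t_n(vu)$) satisfying $t_n(C)=-a^{n+1}$ and, for every word $e_{i_1}\cdots e_{i_k}$ in the generators ($k\ge0$), $$t_n(e_{i_1}\cdots e_{i_k})=a^{k+n}\left(\mathcal{N}(\bar e_{i_1}\cdots\bar e_{i_k})-k\right),$$ where $\mathcal{N}(\bar e_{i_1}\cdots\bar e_{i_k})$ denotes the number of connected components of the diagrammatic closure of $\bar e_{i_1}\cdots\bar e_{i_k}\in TL_n$.
   Context: $A=\mathbb{Q}[a,x,x^{-1}]/(a^2-1)$, $A_1=A/(x-a)$, $\tilde\delta=2-ax$. $\widetilde{TL}_n$ is the unital $A$-algebra with generators $e_1,\dots,e_{n-1},C$ and relations $e_i^2=\tilde\delta x^{-1}e_i$; $e_iC=Ce_i=\tilde\delta x^{-1}C$; $C^2=2x^{-2}\tilde\delta(a-x)C$; $e_ie_j=e_je_i$ if $|i-j|\ge2$; $e_ie_je_i=e_i+\frac{2a}{x}C$ if $|i-j|=1$. $\widetilde{TL}_n(1)=\widetilde{TL}_n\otimes_A A_1$ (in which $e_i^2=ae_i$, $e_iC=Ce_i=aC$, $C^2=0$, $e_ie_{i\pm1}e_i=e_i+2C$). $TL_n$ is the quotient of $\widetilde{TL}_n$ by the ideal generated by $C$ (a Temperley-Lieb algebra), and $\bar e_i$ is the image of $e_i$, represented by the usual cup-cap diagram on $n$ strands joining the adjacent points $i,i+1$ at the top and at the bottom. For a word $\bar e_{i_1}\cdots\bar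 e_{i_k}$, one stacks the corresponding diagrams (keeping all closed loops that are created) and closes the resulting diagram by joining the $j$-th top point to the $j$-th bottom point for each $j$; $\mathcal{N}$ is the total number of resulting closed curves (for the empty word, $\mathcal{N}=n$). *)

(* Defs.v *)
From HB Require Import structures.
From mathcomp Require Import all_boot all_algebra.
From mathcomp Require Import finmap boolp.
From mathcomp.multinomials Require Import monalg.

Set Implicit Arguments.
Unset Strict Implicit.
Unset Printing Implicit Defensive.

Import GRing.Theory.
Local Open Scope ring_scope.
Local Open Scope quotient_scope.

(* The two-sided ideal of R generated by the differences u - v with E u v. *)
Inductive ideal_gen (R : pzRingType) (E : R -> R -> Prop) : R -> Prop :=
| ideal_genE u v of E u v : ideal_gen E (u - v)
| ideal_gen0 : ideal_gen E 0
| ideal_genD u v of ideal_gen E u & ideal_gen E v : ideal_gen E (u + v)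
| ideal_genMl r u of ideal_gen E u : ideal_gen E (r * u)
| ideal_genMr r u of ideal_gen E u : ideal_gen E (u * r).

Section RingQuotient.
Variables (R : pzRingType) (E : R -> R -> Prop).
Local Notation I := (ideal_gen E).

Lemma ideal_genN u : I u -> I (- u).
Proof. by rewrite -mulN1r; apply: ideal_genMl. Qed.

Definition quot_equiv (u v : R) : bool := `[< I (u - v) >].

Lemma quot_equiv_is_equiv : equiv_class_of quot_equiv.
Proof.
split=> [u|u v|v u w].
- by rewrite /quot_equiv subrr; apply/asboolP/ideal_gen0.
- by apply/asboolP/asboolP => /ideal_genN; rewrite opprB.
- move=> /asboolP uv /asboolP vw; apply/asboolP.
  by rewrite -[u - w](subrKA v); apply: ideal_genD.
Qed.

Canonical quot_equiv_equiv := EquivRelPack quot_equiv_is_equiv.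
Canonical quot_equiv_encModRel := defaultEncModRel quot_equiv.

Definition rquot := {eq_quot quot_equiv}.

HB.instance Definition _ : EqQuotient R quot_equiv rquot :=
  EqQuotient.on rquot.
HB.instance Definition _ := Choice.on rquot.

Definition rquot_pi (u : R) : rquot := \pi_rquot u.

Lemma rquot_piP u v : rquot_pi u = rquot_pi v <-> I (u - v).
Proof.
split; first by move=> /eqmodP /asboolP.
by move=> uv; apply/eqmodP/asboolP.
Qed.

Lemma rquot_repr q : rquot_pi (repr q) = q.
Proof. exact: reprK. Qed.

Lemma repr_rquot u : I (repr (rquot_pi u) - u).
Proof. by apply/rquot_piP; rewrite rquot_repr. Qed.

Definition rquot_zero : rquot := rquot_pi 0.
Definition rquot_one : rquot := rquot_pi 1.
Definition rquot_opp (p : rquot) : rquot := rquot_pi (- repr p).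
Definition rquot_add (p q : rquot) : rquot := rquot_pi (repr p + repr q).
Definition rquot_mul (p q : rquot) : rquot := rquot_pi (repr p * repr q).

Lemma rquot_oppE u : rquot_opp (rquot_pi u) = rquot_pi (- u).
Proof.
by apply/rquot_piP; rewrite -opprD; apply/ideal_genN/repr_rquot.
Qed.

Lemma rquot_addE u v :
  rquot_add (rquot_pi u) (rquot_pi v) = rquot_pi (u + v).
Proof.
apply/rquot_piP; rewrite opprD addrACA.
by apply: ideal_genD; apply: repr_rquot.
Qed.

Lemma rquot_mulE u v :
  rquot_mul (rquot_pi u) (rquot_pi v) = rquot_pi (u * v).
Proof.
apply/rquot_piP; rewrite -(subrKA (u * repr (rquot_pi v))) -mulrBl -mulrBr.
apply: ideal_genD; first exact/ideal_genMr/repr_rquot.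
exact/ideal_genMl/repr_rquot.
Qed.

Lemma rquot_ind (P : rquot -> Prop) : (forall u, P (rquot_pi u)) -> forall q, P q.
Proof. by move=> h q; rewrite -(rquot_repr q). Qed.

Lemma rquot_addA : associative rquot_add.
Proof.
elim/rquot_ind=> u; elim/rquot_ind=> v; elim/rquot_ind=> w.
by rewrite !rquot_addE addrA.
Qed.
Lemma rquot_addC : commutative rquot_add.
Proof. by elim/rquot_ind=> u; elim/rquot_ind=> v; rewrite !rquot_addE addrC. Qed.
Lemma rquot_add0 : left_id rquot_zero rquot_add.
Proof. by elim/rquot_ind=> u; rewrite rquot_addE add0r. Qed.
Lemma rquot_addN : left_inverse rquot_zero rquot_opp rquot_add.
Proof. by elim/rquot_ind=> u; rewrite rquot_oppE rquot_addE addNr. Qed.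

HB.instance Definition _ := GRing.isZmodule.Build rquot
  rquot_addA rquot_addC rquot_add0 rquot_addN.

Lemma rquot_mulA : associative rquot_mul.
Proof.
elim/rquot_ind=> u; elim/rquot_ind=> v; elim/rquot_ind=> w.
by rewrite !rquot_mulE mulrA.
Qed.
Lemma rquot_mul1 : left_id rquot_one rquot_mul.
Proof. by elim/rquot_ind=> u; rewrite rquot_mulE mul1r. Qed.
Lemma rquot_mulr1 : right_id rquot_one rquot_mul.
Proof. by elim/rquot_ind=> u; rewrite rquot_mulE mulr1. Qed.
Lemma rquot_mulDl : left_distributive rquot_mul +%R.
Proof.
elim/rquot_ind=> u; elim/rquot_ind=> v; elim/rquot_ind=> w.
by rewrite [_ + _]rquot_addE !rquot_mulE [RHS]rquot_addE mulrDl.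
Qed.
Lemma rquot_mulDr : right_distributive rquot_mul +%R.
Proof.
elim/rquot_ind=> u; elim/rquot_ind=> v; elim/rquot_ind=> w.
by rewrite [_ + _]rquot_addE !rquot_mulE [RHS]rquot_addE mulrDr.
Qed.

HB.instance Definition _ := GRing.Zmodule_isPzRing.Build rquot
  rquot_mulA rquot_mul1 rquot_mulr1 rquot_mulDl rquot_mulDr.

Lemma rquot_pi_is_zmod_morphism : zmod_morphism rquot_pi.
Proof. by move=> u v; rewrite -rquot_addE -rquot_oppE. Qed.
Lemma rquot_pi_is_monoid_morphism : monoid_morphism rquot_pi.
Proof. by split=> // u v; rewrite -rquot_mulE. Qed.

HB.instance Definition _ :=
  GRing.isZmodMorphism.Build R rquot rquot_pi rquot_pi_is_zmod_morphism.
HB.instance Definition _ :=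
  GRing.isMonoidMorphism.Build R rquot rquot_pi rquot_pi_is_monoid_morphism.

Lemma rquot_rel u v : E u v -> rquot_pi u = rquot_pi v.
Proof. by move=> uv; apply/rquot_piP/ideal_genE. Qed.

Section Lift.
Variables (S : pzRingType) (f : {rmorphism R -> S}).
Hypothesis fE : forall u v, E u v -> f u = f v.

Definition rquot_lift (_ : forall u v, E u v -> f u = f v) (q : rquot) : S :=
  f (repr q).
Local Notation lift := (rquot_lift fE).

Lemma rquot_liftE u : lift (rquot_pi u) = f u.
Proof.
apply/eqP; rewrite -subr_eq0 -rmorphB; apply/eqP.
elim: (repr_rquot u) => {u} [u v /fE uv||u v _ fu _ fv|r u _ fu|r u _ fu].
- by rewrite rmorphB uv subrr.
- exact: rmorph0.
- by rewrite rmorphD fu fv addr0.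
- by rewrite rmorphM fu mulr0.
- by rewrite rmorphM fu mul0r.
Qed.

Lemma rquot_lift_is_zmod_morphism : zmod_morphism lift.
Proof.
elim/rquot_ind=> u; elim/rquot_ind=> v.
by rewrite -rmorphB !rquot_liftE rmorphB.
Qed.
Lemma rquot_lift_is_monoid_morphism : monoid_morphism lift.
Proof.
split; first by rewrite -(rmorph1 rquot_pi) rquot_liftE rmorph1.
elim/rquot_ind=> u; elim/rquot_ind=> v.
by rewrite -rmorphM !rquot_liftE rmorphM.
Qed.

HB.instance Definition _ :=
  GRing.isZmodMorphism.Build rquot S lift rquot_lift_is_zmod_morphism.
HB.instance Definition _ :=
  GRing.isMonoidMorphism.Build rquot S lift rquot_lift_is_monoid_morphism.
End Lift.

Lemma rquot_neq0 (S : nzRingType) (f : {rmorphism R -> S}) :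
  (forall u v, E u v -> f u = f v) -> (1 : rquot) != 0.
Proof.
move=> fE; apply/eqP => /(congr1 (rquot_lift fE)) /eqP.
by rewrite rmorph1 rmorph0 oner_eq0.
Qed.

End RingQuotient.

Section ComRingQuotient.
Variables (R : comPzRingType) (E : R -> R -> Prop).

Lemma rquot_mulC : commutative (@GRing.mul (rquot E)).
Proof.
by elim/rquot_ind=> u; elim/rquot_ind=> v; rewrite -!rmorphM mulrC.
Qed.

HB.instance Definition _ :=
  GRing.PzRing_hasCommutativeMul.Build (rquot E) rquot_mulC.
End ComRingQuotient.

Section QuotientAlgebra.
Variables (k : pzRingType) (R : algType k) (E : R -> R -> Prop).
Local Notation Q := (rquot E).

Definition rquot_scale (c : k) (q : Q) : Q := rquot_pi E (c *: repr q).

Lemma rquot_scaleE c u : rquot_scale c (rquot_pi E u) = rquot_pi E (c *: u).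
Proof.
apply/rquot_piP; rewrite -scalerBr -[_ - u]mul1r scalerAl.
exact/ideal_genMl/repr_rquot.
Qed.

Lemma rquot_scaleA c d q :
  rquot_scale c (rquot_scale d q) = rquot_scale (c * d) q.
Proof. by elim/rquot_ind: q => u; rewrite !rquot_scaleE scalerA. Qed.
Lemma rquot_scale1 : left_id 1 rquot_scale.
Proof. by elim/rquot_ind=> u; rewrite rquot_scaleE scale1r. Qed.
Lemma rquot_scaleDr : right_distributive rquot_scale +%R.
Proof.
move=> c; elim/rquot_ind=> u; elim/rquot_ind=> v.
by rewrite -rmorphD !rquot_scaleE -rmorphD scalerDr.
Qed.
Lemma rquot_scaleDl q : {morph rquot_scale^~ q : c d / c + d}.
Proof.
by move=> c d; elim/rquot_ind: q => u; rewrite !rquot_scaleE -rmorphD scalerDl.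
Qed.

HB.instance Definition _ := GRing.Zmodule_isLmodule.Build k Q
  rquot_scaleA rquot_scale1 rquot_scaleDr rquot_scaleDl.

Lemma rquot_pi_is_scalable : scalable (rquot_pi E).
Proof. by move=> c u; rewrite -rquot_scaleE. Qed.

HB.instance Definition _ :=
  GRing.isScalable.Build k R Q *:%R (rquot_pi E) rquot_pi_is_scalable.

Lemma rquot_piZ c u : rquot_pi E (c *: u) = c *: rquot_pi E u.
Proof. exact: rquot_pi_is_scalable. Qed.

Lemma rquot_scalerAl (c : k) (p q : Q) : c *: (p * q) = (c *: p) * q.
Proof.
elim/rquot_ind: p => u; elim/rquot_ind: q => v.
by rewrite -rquot_piZ -!rmorphM -rquot_piZ scalerAl.
Qed.

Lemma rquot_scalerAr (c : k) (p q : Q) : c *: (p * q) = p * (c *: q).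
Proof.
elim/rquot_ind: p => u; elim/rquot_ind: q => v.
by rewrite -rquot_piZ -!rmorphM -rquot_piZ scalerAr.
Qed.
End QuotientAlgebra.

(* {malg k[{fmonom G}]} is the free associative unital k-algebra k<G>. *)
Section FreeAlgebra.
Variables (k : comNzRingType) (G : choiceType).

Definition free_alg := {malg k[{fmonom G}]}.
HB.instance Definition _ := GRing.Lalgebra.on free_alg.

Lemma free_alg_scalerAr (c : k) (u v : {malg k[{fmonom G}]}) :
  c *: (u * v) = u * (c *: v).
Proof.
apply/malgP => w; apply: etrans (mcoeffZ _ _ _) _.
apply: etrans (congr1 _ (mcoeffMl u v w)) _.
rewrite (mcoeffMlw w (fsubset_refl (msupp u)) (msuppZ_le c v)).
rewrite mulr_sumr; apply: eq_bigr => i _; rewrite mulr_sumr; apply: eq_bigr => j _.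
by rewrite mcoeffZ (mulrCA u@_i) mulrnAr.
Qed.

HB.instance Definition _ :=
  GRing.Lalgebra_isAlgebra.Build k free_alg free_alg_scalerAr.

End FreeAlgebra.

HB.lock Definition free_gen (k : comNzRingType) (G : choiceType) (g : G)
  : free_alg k G := << fmu g >>.

Section FreeAlgebraEval.
Variables (k : comNzRingType) (G : choiceType) (S : comNzRingType) (h : G -> S).

Definition word_eval (w : {fmonom G}) : S := \prod_(g <- (w : seq G)) h g.

Lemma word_eval_mmorphism : mmorphism word_eval.
Proof.
split; last by rewrite /word_eval fm1 big_nil.
by move=> v w; rewrite /word_eval fmM big_cat.
Qed.

HB.instance Definition _ :=
  isMultiplicative.Build {fmonom G} S word_eval word_eval_mmorphism.

Lemma word_evalU g : word_eval (fmu g) = h g.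
Proof. by rewrite /word_eval fmU big_seq1. Qed.

Definition free_eval (f : {rmorphism k -> S}) :
  {rmorphism free_alg k G -> S} := mmap f word_eval.

Lemma free_eval_gen f g : free_eval f (free_gen k g) = h g.
Proof.
rewrite free_gen.unlock /= mmapU -[LHS]/(f 1 * word_eval (fmu g)).
by rewrite rmorph1 mul1r word_evalU.
Qed.

Lemma free_evalZ f c u : free_eval f (c *: u) = f c * free_eval f u.
Proof. exact: mmapZ. Qed.
End FreeAlgebraEval.

(* The extension of scalars B ⊗_k k' along phi, generated as a k'-algebra by
   the pure tensors b ⊗ c, with k' acting on the right-hand factor. *)
Section ScalarExtension.
Variables (k k' : comNzRingType) (phi : {rmorphism k -> k'}) (B : algType k).

Definition tens_free := free_alg k' (B * k')%type.
HB.instance Definition _ := GRing.Algebra.on tens_free.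

Definition pure_free (b : B) (c : k') : tens_free := free_gen k' (b, c).

Inductive tens_rel : tens_free -> tens_free -> Prop :=
| tens_Dl b b' c :
    tens_rel (pure_free (b + b') c) (pure_free b c + pure_free b' c)
| tens_Dr b c c' :
    tens_rel (pure_free b (c + c')) (pure_free b c + pure_free b c')
| tens_bal r b c :
    tens_rel (pure_free (r *: b) c) (pure_free b (phi r * c))
| tens_Z r b c :
    tens_rel (r *: pure_free b c) (pure_free b (r * c))
| tens_1 :
    tens_rel 1 (pure_free 1 1)
| tens_M b b' c c' :
    tens_rel (pure_free b c * pure_free b' c') (pure_free (b * b') (c * c')).

Definition tens := rquot tens_rel.
HB.instance Definition _ := GRing.PzRing.on tens.
HB.instance Definition _ := GRing.Lmodule.on tens.

Definition pure (b : B) (c : k') : tens := rquot_pi tens_rel (pure_free b c).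

Section Neq0.
Variable eps : {rmorphism B -> k}.
Hypothesis epsZ : forall r b, eps (r *: b) = r * eps b.

Let ev : {rmorphism tens_free -> k'} :=
  free_eval (fun bc : B * k' => phi (eps bc.1) * bc.2) idfun.

Lemma tens_neq0 : (1 : tens) != 0.
Proof.
have evE b c : ev (pure_free b c) = phi (eps b) * c by exact: free_eval_gen.
have evM u v : ev (u * v) = ev u * ev v by exact: rmorphM.
have evD u v : ev (u + v) = ev u + ev v by exact: rmorphD.
have evZ c u : ev (c *: u) = c * ev u by exact: free_evalZ.
have ev1 : ev 1 = 1 by exact: rmorph1.
apply: (rquot_neq0 (f := ev)) => u v.
case=> [b b' c|b c c'|r b c|r b c||b b' c c'].
- by rewrite evD !evE !rmorphD mulrDl.
- by rewrite evD !evE mulrDr.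
- by rewrite !evE epsZ rmorphM mulrCA mulrA.
- by rewrite evZ !evE mulrCA.
- by rewrite ev1 evE !rmorph1 mulr1.
- by rewrite evM !evE !rmorphM mulrACA.
Qed.
End Neq0.
End ScalarExtension.

(* {malg rat[{cmonom 'I_3}]} is the commutative polynomial ring Q[a, x, y];
   Q[a, x, x^-1] is its quotient by x y = 1. *)
Definition Qaxy := {malg rat[{cmonom 'I_3}]}.
HB.instance Definition _ := GRing.ComNzRing.on Qaxy.

HB.lock Definition polyvar (i : 'I_3) : Qaxy := << ucm i >>.
Definition var_a : Qaxy := polyvar (@Ordinal 3 0 isT).
Definition var_x : Qaxy := polyvar (@Ordinal 3 1 isT).
Definition var_y : Qaxy := polyvar (@Ordinal 3 2 isT).

Inductive A_rel : Qaxy -> Qaxy -> Prop :=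
| A_rel_inv : A_rel (var_x * var_y) 1
| A_rel_a2 : A_rel (var_a ^+ 2 - 1) 0.

Definition ringA := rquot A_rel.
HB.instance Definition _ := GRing.ComPzRing.on ringA.

(* The specialization a = x = y = 1 shows that ringA and ringA1 are nonzero. *)
Definition cmonom_eval1 (m : {cmonom 'I_3}) : rat := 1.

Lemma cmonom_eval1_mmorphism : mmorphism cmonom_eval1.
Proof. by split=> // u v; rewrite /cmonom_eval1 mulr1. Qed.

HB.instance Definition _ :=
  isMultiplicative.Build {cmonom 'I_3} rat cmonom_eval1 cmonom_eval1_mmorphism.

Definition Qaxy_eval1 : {rmorphism Qaxy -> rat} := mmap idfun cmonom_eval1.

Lemma Qaxy_eval1_var i : Qaxy_eval1 (polyvar i) = 1.
Proof. by rewrite polyvar.unlock /= mmapU mulr1. Qed.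

Lemma Qaxy_eval1_rel u v : A_rel u v -> Qaxy_eval1 u = Qaxy_eval1 v.
Proof.
case.
  rewrite (rmorphM Qaxy_eval1) !Qaxy_eval1_var mulr1; exact: esym (rmorph1 _).
rewrite (rmorphB Qaxy_eval1) (rmorphXn Qaxy_eval1) Qaxy_eval1_var.
rewrite (rmorph1 Qaxy_eval1) (rmorph0 Qaxy_eval1).
by rewrite expr1n subrr.
Qed.

HB.instance Definition _ :=
  GRing.PzSemiRing_isNonZero.Build ringA (rquot_neq0 Qaxy_eval1_rel).

Definition aA : ringA := rquot_pi A_rel var_a.
Definition xA : ringA := rquot_pi A_rel var_x.
Definition xVA : ringA := rquot_pi A_rel var_y.

Lemma mulAxV : xA * xVA = 1.
Proof.
by rewrite -rmorphM -(rmorph1 (rquot_pi A_rel)); apply: rquot_rel A_rel_inv.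
Qed.

Lemma sqrAa : aA ^+ 2 = 1.
Proof.
apply/eqP; rewrite -subr_eq0 -(rmorph1 (rquot_pi A_rel)) -rmorphXn -rmorphB.
by apply/eqP; rewrite -(rmorph0 (rquot_pi A_rel)); apply: rquot_rel A_rel_a2.
Qed.

Inductive A1_rel : ringA -> ringA -> Prop := A1_rel_xa : A1_rel (xA - aA) 0.

Definition ringA1 := rquot A1_rel.
HB.instance Definition _ := GRing.ComPzRing.on ringA1.

Definition A_to_A1 : {rmorphism ringA -> ringA1} := rquot_pi A1_rel.

Definition A_eval1 : {rmorphism ringA -> rat} := rquot_lift Qaxy_eval1_rel.

Lemma A_eval1E p : A_eval1 (rquot_pi A_rel p) = Qaxy_eval1 p.
Proof. exact: rquot_liftE. Qed.

Lemma A_eval1_rel u v : A1_rel u v -> A_eval1 u = A_eval1 v.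
Proof.
case; rewrite (rmorphB A_eval1) (rmorph0 A_eval1) /xA /aA !A_eval1E.
by rewrite !Qaxy_eval1_var subrr.
Qed.

HB.instance Definition _ :=
  GRing.PzSemiRing_isNonZero.Build ringA1 (rquot_neq0 A_eval1_rel).

Definition delta : ringA := 2 - aA * xA.

(* Generators of TLt n: None is C, and Some i is e_(i+1) for i < n - 1. *)
Definition TL_free (n : nat) := free_alg ringA (option 'I_n.-1).
HB.instance Definition _ n := GRing.Algebra.on (TL_free n).

Definition free_C n : TL_free n := free_gen ringA (None : option 'I_n.-1).
Definition free_e n (i : 'I_n.-1) : TL_free n := free_gen ringA (Some i).

Inductive TL_rel (n : nat) : TL_free n -> TL_free n -> Prop :=
| TL_ee i :
    TL_rel (free_e i ^+ 2) ((delta * xVA) *: free_e i)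
| TL_eC i :
    TL_rel (free_e i * free_C n) ((delta * xVA) *: free_C n)
| TL_Ce i :
    TL_rel (free_C n * free_e i) ((delta * xVA) *: free_C n)
| TL_CC :
    TL_rel (free_C n ^+ 2)
           ((2 * xVA ^+ 2 * delta * (aA - xA)) *: free_C n)
| TL_far (i j : 'I_n.-1) of (2 <= `|i - j|)%N :
    TL_rel (free_e i * free_e j) (free_e j * free_e i)
| TL_near (i j : 'I_n.-1) of `|i - j|%N = 1%N :
    TL_rel (free_e i * free_e j * free_e i)
           (free_e i + (2 * aA * xVA) *: free_C n).

Definition TLt (n : nat) := rquot (@TL_rel n).
HB.instance Definition _ n := GRing.PzRing.on (TLt n).
HB.instance Definition _ n := GRing.Lmodule.on (TLt n).

Definition TL_free_aug n : {rmorphism TL_free n -> ringA} :=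
  free_eval (fun _ : option 'I_n.-1 => 0 : ringA) idfun.

Lemma TL_free_aug_C n : TL_free_aug n (free_C n) = 0.
Proof. exact: free_eval_gen. Qed.

Lemma TL_free_aug_e n (i : 'I_n.-1) : TL_free_aug n (free_e i) = 0.
Proof. exact: free_eval_gen. Qed.

Lemma TL_free_augZ n c u : TL_free_aug n (c *: u) = c * TL_free_aug n u.
Proof. exact: free_evalZ. Qed.

Lemma TL_free_augM n u v :
  TL_free_aug n (u * v) = TL_free_aug n u * TL_free_aug n v.
Proof. exact: rmorphM. Qed.

Lemma TL_free_augD n u v :
  TL_free_aug n (u + v) = TL_free_aug n u + TL_free_aug n v.
Proof. exact: rmorphD. Qed.

Lemma TL_free_aug_rel n u v :
  TL_rel u v -> TL_free_aug n u = TL_free_aug n v.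
Proof.
have aC0 := TL_free_aug_C n; have ae0 := TL_free_aug_e (n := n).
have aCZ c : TL_free_aug n (c *: free_C n) = 0.
  by rewrite TL_free_augZ aC0 mulr0.
have aeM i w : TL_free_aug n (free_e i * w) = 0.
  by rewrite TL_free_augM ae0 mul0r.
have aCM w : TL_free_aug n (free_C n * w) = 0.
  by rewrite TL_free_augM aC0 mul0r.
case=> [i|i|i||i j _|i j _].
- by rewrite expr2 aeM TL_free_augZ ae0 mulr0.
- by rewrite aeM aCZ.
- by rewrite aCM aCZ.
- by rewrite expr2 aCM aCZ.
- exact: etrans (aeM i _) (esym (aeM j _)).
- by rewrite TL_free_augM aeM mul0r TL_free_augD ae0 aCZ addr0.
Qed.

HB.instance Definition _ n :=
  GRing.PzSemiRing_isNonZero.Build (TLt n) (rquot_neq0 (@TL_free_aug_rel n)).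
HB.instance Definition _ n :=
  GRing.Lmodule_isLalgebra.Build ringA (TLt n) (@rquot_scalerAl _ _ (@TL_rel n)).
HB.instance Definition _ n :=
  GRing.Lalgebra_isAlgebra.Build ringA (TLt n) (@rquot_scalerAr _ _ (@TL_rel n)).

Definition TLt_aug n : {rmorphism TLt n -> ringA} :=
  rquot_lift (@TL_free_aug_rel n).

Lemma TLt_augE n u : TLt_aug n (rquot_pi (@TL_rel n) u) = TL_free_aug n u.
Proof. exact: rquot_liftE. Qed.

Lemma TLt_augZ n c u : TLt_aug n (c *: u) = c * TLt_aug n u.
Proof.
elim/rquot_ind: u => u; rewrite -(rquot_piZ (@TL_rel n)).
apply: etrans (TLt_augE _) (etrans (TL_free_augZ _ _) _).
by rewrite TLt_augE.
Qed.

Definition TLt_C n : TLt n := rquot_pi (@TL_rel n) (free_C n).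
Definition TLt_e n (i : 'I_n.-1) : TLt n := rquot_pi (@TL_rel n) (free_e i).

Definition TLt1 (n : nat) := tens A_to_A1 (TLt n).
HB.instance Definition _ n := GRing.PzRing.on (TLt1 n).
HB.instance Definition _ n := GRing.Lmodule.on (TLt1 n).

HB.instance Definition _ n := GRing.PzSemiRing_isNonZero.Build (TLt1 n)
  (tens_neq0 A_to_A1 (@TLt_augZ n)).
HB.instance Definition _ n := GRing.Lmodule_isLalgebra.Build ringA1 (TLt1 n)
  (@rquot_scalerAl _ _ (@tens_rel _ _ A_to_A1 (TLt n))).
HB.instance Definition _ n := GRing.Lalgebra_isAlgebra.Build ringA1 (TLt1 n)
  (@rquot_scalerAr _ _ (@tens_rel _ _ A_to_A1 (TLt n))).

Definition TLt1_C n : TLt1 n := pure A_to_A1 (TLt_C n) 1.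
Definition TLt1_e n (i : 'I_n.-1) : TLt1 n := pure A_to_A1 (TLt_e i) 1.

Definition aA1 : ringA1 := A_to_A1 aA.

(* A diagram on n strands is a relation on its 2n boundary points, top points
   being inl j and bottom points inr j; the strands are numbered from 0. *)
Definition cupcap n (i : 'I_n.-1) : rel ('I_n + 'I_n) := fun p q =>
  let joined (j j' : 'I_n) :=
    ((j == i :> nat) && (j' == i.+1 :> nat))
    || ((j' == i :> nat) && (j == i.+1 :> nat)) in
  let through (j j' : 'I_n) := [&& j == j', j != i :> nat & j != i.+1 :> nat] in
  match p, q with
  | inl j, inl j' | inr j, inr j' => joined j j'
  | inl j, inr j' | inr j, inl j' => through j j'
  end.

(* In the stack of the k diagrams of a word, (s, j) is the j-th point of the
   s-th horizontal level: the diagram of the s-th letter lies between the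
   levels s and s + 1. *)
Definition level_pt n k (s : 'I_k) (p : 'I_n + 'I_n) : 'I_k.+1 * 'I_n :=
  match p with
  | inl j => (widen_ord (leqnSn k) s, j)
  | inr j => (lift ord0 s, j)
  end.

Definition stack_edge n (w : seq 'I_n.-1) :
    rel ('I_(size w).+1 * 'I_n) := fun u v =>
  [exists s : 'I_(size w), [exists p, [exists q,
    [&& u == level_pt s p, v == level_pt s q & cupcap (tnth (in_tuple w) s) p q]]]].

Definition closing_edge n k : rel ('I_k.+1 * 'I_n) := fun u v =>
  (u.2 == v.2) && ((u.1 == ord0) && (v.1 == ord_max)
                   || (v.1 == ord0) && (u.1 == ord_max)).

Definition closure_edge n (w : seq 'I_n.-1) :
    rel ('I_(size w).+1 * 'I_n) := fun u v =>
  stack_edge u v || closing_edge u v.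

Lemma closure_edge_sym n (w : seq 'I_n.-1) : symmetric (@closure_edge n w).
Proof.
have cc_sym i : symmetric (@cupcap n i).
  have thr (j j' : 'I_n) :
    [&& j == j', j != i :> nat & j != i.+1 :> nat]
    = [&& j' == j, j' != i :> nat & j' != i.+1 :> nat].
    by rewrite eq_sym; case: eqP => // ->.
  by move=> [j|j] [j'|j'] /=; rewrite 1?orbC.
have sub u v : stack_edge (w := w) u v -> stack_edge (w := w) v u.
  case/existsP=> s /existsP[p /existsP[q /and3P[up vq pq]]].
  apply/existsP; exists s; apply/existsP; exists q; apply/existsP; exists p.
  by rewrite up vq cc_sym.
move=> u v; congr (_ || _); first by apply/idP/idP; apply: sub.
by rewrite /closing_edge eq_sym [in RHS]orbC.
Qed.

(* Every closed curve crosses some level, and the points of one curve form one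
   connected component of the graph of arcs. *)
Definition closed_curves n (w : seq 'I_n.-1) : nat :=
  n_comp (@closure_edge n w) predT.

(* Main.v *)
(* Counting the {0,1}-colorings of the boundary points that are constant along
   arcs gives 2 ^ N for a closed diagram with N closed curves.  A coloring is a
   closed path of colorings of the n strands, one per level, so 2 ^ N is also
   the trace of a product of cup-cap operators E_i on functions of strand
   colorings.  These satisfy the Temperley-Lieb relations with loop value 2,
   and the trace is cyclic, which tells how N changes under each relation.
   The formula of the theorem, extended by - a ^ (k + n + 1) to words with one
   C and k letters e_i and by 0 to words with at least two C, therefore defines
   a functional on the free algebra that is a trace and respects every defining
   relation between arbitrary left and right factors. *)
From HB Require Import structures.
Require Import Defs.
From mathcomp Require Import all_boot all_algebra.
From mathcomp Require Import finmap zify ring.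
From mathcomp.multinomials Require Import monalg.
Import GRing.Theory.
Set Implicit Arguments.
Unset Strict Implicit.
Unset Printing Implicit Defensive.

(** * Closed curves as colorings *)

(** A coloring that respects [e] is constant on components, hence determined by the set of roots
    colored [true]; [h] turns a set of roots into the coloring it determines. *)
Lemma card_colorings (V : finType) (e : rel V) : symmetric e ->
  #|[set f : {ffun V -> bool} | [forall u, forall v, e u v ==> (f u == f v)]]|
  = 2 ^ n_comp e predT.
Proof.
move=> /sym_connect_sym esym.
pose R := [set x | roots e x].
have -> : n_comp e predT = #|R|.
  by rewrite /n_comp_mem; apply: eq_card => x; rewrite !inE andbT.
rewrite -card_powerset.
pose h (A : {set V}) := [ffun u => fingraph.root e u \in A].
have hinj : {in powerset R &, injective h}.
  move=> A B; rewrite !inE => /subsetP AR /subsetP BR /ffunP hAB.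
  apply/setP => x; case: (boolP (x \in R)) => [|xR]; last first.
    by rewrite (contraNF (AR x) xR) (contraNF (BR x) xR).
  by rewrite inE => /eqP xR; have := hAB x; rewrite !ffunE xR.
rewrite -(card_in_imset hinj); apply: eq_card => f.
rewrite inE; apply/idP/imsetP => [/forallP fe|[A AR ->]]; last first.
  apply/forallP => u; apply/forallP => v; apply/implyP => uv.
  by rewrite !ffunE (fingraph.rootP esym (connect1 uv)).
have fconn u v : connect e u v -> f u = f v.
  move=> /connectP[p]; elim: p u => [|w p IH] u /=; first by move=> _ ->.
  move=> /andP[uw pw] vE; rewrite -(IH w pw vE).
  by have /forallP/(_ w)/implyP/(_ uw)/eqP := fe u.
exists [set x in R | f x]; first by rewrite inE; apply/subsetP => x; rewrite inE => /andP[].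
apply/ffunP => u; rewrite ffunE !inE roots_root //=.
exact/fconn/connect_root.
Qed.

(** The product of the 0-1 matrices [E i] over the letters of [w], applied to the vector [F]. *)
Fixpoint transfer (I : Type) (S : finType) (E : I -> rel S) (w : seq I)
    (F : S -> nat) : S -> nat :=
  if w is i :: w' then fun s => \sum_(s' | E i s s') transfer E w' F s' else F.

Lemma sum_paths (I : Type) (S : finType) (E : I -> rel S) (w : seq I)
    (F : S -> nat) (s : S) :
  \sum_(g : {ffun 'I_(size w).+1 -> S} | (g ord0 == s) &&
      [forall t, E (tnth (in_tuple w) t) (g (widen_ord (leqnSn _) t)) (g (lift ord0 t))])
    F (g ord_max)
  = transfer E w F s.
Proof.
elim: w s => [|i w IH] s /=.
  rewrite (big_pred1 [ffun=> s]) ?ffunE // => g /=.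
  apply/andP/eqP => [[/eqP gs _]|->].
    by apply/ffunP => t; rewrite ffunE (ord1 t).
  by rewrite ffunE eqxx; split=> //; apply/forallP => - [].
under [RHS]eq_bigr do rewrite -IH.
rewrite [RHS](exchange_big_dep predT) //=.
(* [k] prepends the start [s] to a path and [k'] drops the first vertex, so [k] parametrizes the
   paths from [s] by their tails. *)
pose k (g : {ffun 'I_(size w).+1 -> S}) : {ffun 'I_(size w).+2 -> S} :=
  [ffun t : 'I_(size w).+2 => if unlift ord0 t is Some t' then g t' else s].
pose k' (g : {ffun 'I_(size w).+2 -> S}) : {ffun 'I_(size w).+1 -> S} := [ffun t : 'I_(size w).+1 => g (lift ord0 t)].
have k0 g : k g ord0 = s by rewrite ffunE unlift_none.
have kS g t : k g (lift ord0 t) = g t by rewrite ffunE liftK.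
rewrite (reindex_onto k k') /=; last first.
  move=> g /andP[/eqP gs _]; apply/ffunP => t; rewrite ffunE.
  by case: unliftP => [t' ->|->] //; rewrite ffunE.
(* Both sides reduce to a sum over tails [g] alone: the first step [s'] can only be [g ord0]. *)
transitivity (\sum_(g : {ffun 'I_(size w).+1 -> S}) if E i s (g ord0) &&
  [forall t, E (tnth (in_tuple w) t) (g (widen_ord (leqnSn (size w)) t)) (g (lift ord0 t))]
  then F (g ord_max) else 0); last first.
  apply: eq_bigr.
  move=> g _; case: ifP => [/andP[E0 Eg]|nE].
    rewrite (big_pred1 (g ord0)) // => s'; rewrite Eg andbT [RHS]eq_sym.
    by case: (g ord0 =P s') => [Es'|_]; rewrite ?andbF // -Es' E0.
  rewrite big_pred0 // => s'; apply: contraFF nE => /and3P[Es /eqP -> ->].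
  by rewrite Es.
rewrite -big_mkcond /=; apply: eq_big => [g|g _]; last first.
  by congr F; rewrite -(kS g); congr (k g _); apply: val_inj.
rewrite k0 eqxx /=.
have -> : k' (k g) == g by apply/eqP/ffunP => t; rewrite [LHS]ffunE kS.
rewrite andbT; apply/forallP/andP => [Eg|[E0 /forallP Eg] t].
  split.
    have := Eg ord0; rewrite kS (_ : widen_ord _ _ = ord0) ?k0; last exact: val_inj.
    by rewrite (tnth_nth i).
  apply/forallP => t; have := Eg (lift ord0 t); rewrite kS.
  rewrite (_ : widen_ord _ _ = lift ord0 (widen_ord (leqnSn _) t)) ?kS; last exact: val_inj.
  by rewrite !(tnth_nth i).
case: (unliftP ord0 t) => [t' ->|->]; rewrite kS.
  rewrite (_ : widen_ord _ _ = lift ord0 (widen_ord (leqnSn _) t')) ?kS; last exact: val_inj.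
  by have := Eg t'; rewrite !(tnth_nth i).
rewrite (_ : widen_ord _ _ = ord0) ?k0; last exact: val_inj.
by rewrite (tnth_nth i).
Qed.

(** * Cup-cap operators *)

Section Operators.
Variable n : nat.
Local Notation S := {ffun 'I_n -> bool}.
Local Notation I := 'I_n.-1.

Lemma lo_subproof (i : I) : i < n. Proof. by case: n i => [[]|m i] //=; apply/ltnW/ltn_ord. Qed.
Lemma hi_subproof (i : I) : i.+1 < n.
Proof. by case: n i => [[]|m i] //=; rewrite ltnS; apply: ltn_ord. Qed.
Definition lo i := Ordinal (lo_subproof i).
Definition hi i := Ordinal (hi_subproof i).

Definition recolor (i : I) b (s : S) : S :=
  [ffun j => if (j == lo i) || (j == hi i) then b else s j].

(** The usual Temperley-Lieb generator on the n-th tensor power of a two-dimensional space, written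
    on functions of colorings: the top arc demands equal colors, the bottom arc takes either
    color. *)
Definition cupcap_op (i : I) (F : S -> nat) (s : S) : nat :=
  if s (lo i) == s (hi i) then \sum_b F (recolor i b s) else 0.

Definition boundary (s s' : S) (p : 'I_n + 'I_n) : bool :=
  match p with inl j => s j | inr j => s' j end.

Definition compatible (i : I) : rel S := fun s s' =>
  [forall p, forall q, cupcap i p q ==> (boundary s s' p == boundary s s' q)].

(** The top arc gives the test on [s], the bottom arc the common free color of [s'], and the
    vertical strands the agreement elsewhere. *)
Lemma compatibleE i s s' : compatible i s s' =
  (s (lo i) == s (hi i)) && (s' == recolor i (s' (lo i)) s).
Proof.
apply/forallP/andP => [cc|[/eqP sc /eqP s'E]].
  have {}cc p q : cupcap i p q -> boundary s s' p = boundary s s' q.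
    by move=> pq; have /forallP/(_ q)/implyP/(_ pq)/eqP := cc p.
  split; first by have /= -> // := cc (inl (lo i)) (inl (hi i)); rewrite /= !eqxx.
  apply/eqP/ffunP => j; rewrite ffunE; case: ifP => [/orP[]/eqP->//|].
    by have /= -> // := cc (inr (lo i)) (inr (hi i)); rewrite /= !eqxx.
  move=> /norP[jl jh]; have /= -> // := cc (inl j) (inr j).
  by rewrite eqxx /=; apply/andP; split.
have jE (j j' : 'I_n) : (j == i :> nat) && (j' == i.+1 :> nat)
    || (j' == i :> nat) && (j == i.+1 :> nat) ->
    (j, j') = (lo i, hi i) \/ (j, j') = (hi i, lo i).
  move=> /orP[]/andP[/eqP jE /eqP j'E]; [left|right];
    by congr pair; apply: val_inj.
have s'l : s' (lo i) = s' (hi i).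
  by rewrite s'E !ffunE !eqxx orbT.
have s'o (j : 'I_n) : j != i :> nat -> j != i.+1 :> nat -> s' j = s j.
  move=> jl jh; rewrite s'E ffunE ifF //; apply/negbTE/norP; split; apply/eqP => E.
    by rewrite E /= eqxx in jl.
  by rewrite E /= eqxx in jh.
case=> j; apply/forallP; case=> j'; apply/implyP => /=.
- by move=> /jE [] [-> ->]; rewrite sc.
- by move=> /and3P[/eqP <- jl jh]; rewrite s'o.
- by move=> /and3P[/eqP <- jl jh]; rewrite s'o.
- by move=> /jE [] [-> ->]; rewrite s'l.
Qed.

Lemma sum_compatible i F s :
  \sum_(s' | compatible i s s') F s' = cupcap_op i F s.
Proof.
rewrite /cupcap_op; under eq_bigl do rewrite compatibleE.
case: ifP => _ /=; last by rewrite big_pred0.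
rewrite (reindex_onto (fun b => recolor i b s) (fun s' => s' (lo i))) /=; last first.
  by move=> s' /eqP.
by apply: eq_bigl => b; rewrite ffunE eqxx /= !eqxx.
Qed.

Definition word_op (w : seq I) (F : S -> nat) : S -> nat := foldr cupcap_op F w.

Lemma cupcap_op_ext i F G : F =1 G -> cupcap_op i F =1 cupcap_op i G.
Proof. by move=> FG s; rewrite /cupcap_op; under eq_bigr do rewrite FG. Qed.

Lemma word_op_ext w F G : F =1 G -> word_op w F =1 word_op w G.
Proof. by move=> FG; elim: w => //= i w; apply: cupcap_op_ext. Qed.

Lemma word_op_cat w1 w2 F : word_op (w1 ++ w2) F = word_op w1 (word_op w2 F).
Proof. exact: foldr_cat. Qed.

Lemma transfer_word_op w F : transfer compatible w F =1 word_op w F.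
Proof.
elim: w => //= i w IH s; rewrite sum_compatible.
exact: cupcap_op_ext.
Qed.

(** Linearity, with [F] expanded in the basis of indicator functions of single colorings. It turns a
    composition of operators into a matrix product, as cyclicity of the trace requires. *)
Lemma word_op_sum w F s :
  word_op w F s = \sum_r F r * word_op w (fun s' => s' == r) s.
Proof.
elim: w s => [|i w IH] s /=.
  rewrite (bigD1 s) //= eqxx muln1 big1 ?addn0 // => r rs.
  by rewrite eq_sym (negbTE rs) muln0.
rewrite {1}/cupcap_op; under [RHS]eq_bigr do rewrite /cupcap_op.
case: ifP => _; last by rewrite big1 // => r; rewrite muln0.
under eq_bigr do rewrite IH.
by rewrite exchange_big; apply: eq_bigr => r _; rewrite big_distrr.
Qed.

(** The trace of [word_op w] in the basis of indicator functions. *)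
Definition word_tr w := \sum_s word_op w (fun s' => s' == s) s.

Lemma word_tr_catC w1 w2 : word_tr (w1 ++ w2) = word_tr (w2 ++ w1).
Proof.
rewrite /word_tr.
under eq_bigr do rewrite word_op_cat word_op_sum.
under [RHS]eq_bigr do rewrite word_op_cat word_op_sum.
by rewrite exchange_big; do 2!apply: eq_bigr => ? _; rewrite mulnC.
Qed.

Lemma eq_word_tr u w1 w2 v : (forall F, word_op w1 F =1 word_op w2 F) ->
  word_tr (u ++ w1 ++ v) = word_tr (u ++ w2 ++ v).
Proof.
move=> w12; apply: eq_bigr => s _; rewrite !word_op_cat.
exact: word_op_ext (w12 _) s.
Qed.

Lemma recolor_recolor i b b' s : recolor i b (recolor i b' s) = recolor i b s.
Proof. by apply/ffunP => j; rewrite !ffunE; case: (_ || _). Qed.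

Lemma recolor_lo i b s : recolor i b s (lo i) = b.
Proof. by rewrite ffunE eqxx. Qed.
Lemma recolor_hi i b s : recolor i b s (hi i) = b.
Proof. by rewrite ffunE eqxx orbT. Qed.

Lemma recolor_other i b s k : k != lo i -> k != hi i -> recolor i b s k = s k.
Proof. by move=> /negbTE kl /negbTE kh; rewrite ffunE kl kh. Qed.

(** After the first recoloring the second test always passes, and the second recoloring overwrites
    the first, whose two colors give the factor 2 of a closed loop. *)
Lemma cupcap_op2 i F s : cupcap_op i (cupcap_op i F) s = 2 * cupcap_op i F s.
Proof.
rewrite /cupcap_op; case: ifP => _ //.
under eq_bigr do [rewrite recolor_lo recolor_hi eqxx; under eq_bigr do rewrite recolor_recolor].
by rewrite big_const card_bool iter_addn_0 mulnC.
Qed.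

(** The four points are distinct, so the recolorings commute and neither affects the test of the
    other. *)
Lemma cupcap_op_far (i j : I) F s : (2 <= `|i - j|)%N ->
  cupcap_op i (cupcap_op j F) s = cupcap_op j (cupcap_op i F) s.
Proof.
move=> ij.
have [lij lhij hlij hij] : [/\ lo i != lo j, lo i != hi j, hi i != lo j & hi i != hi j].
  by rewrite -!val_eqE /=; split; lia.
have recC b b' r : recolor j b' (recolor i b r) = recolor i b (recolor j b' r).
  apply/ffunP => k; rewrite !ffunE.
  case: (eqVneq k (lo i)) => [->|_]; first by rewrite (negbTE lij) (negbTE lhij).
  by case: (eqVneq k (hi i)) => [->|_]; rewrite // (negbTE hlij) (negbTE hij).
rewrite /cupcap_op.
have [lji lhji hlji hji] : [/\ lo j != lo i, lo j != hi i, hi j != lo i & hi j != hi i].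
  by split; rewrite eq_sym.
under eq_bigr do rewrite !recolor_other //.
under [in RHS]eq_bigr do rewrite !recolor_other //.
case: ifP => si; case: ifP => sj //; try by rewrite big1.
rewrite exchange_big; apply: eq_bigr => b _; apply: eq_bigr => b' _.
by rewrite recC.
Qed.

(* c is the color of the strand that j meets and i does not. *)
Lemma recolor_near (i j : I) s : `|i - j|%N = 1%N -> exists c, [/\
    forall b, (recolor i b s (lo j) == recolor i b s (hi j)) = (b == c),
    forall b b', (recolor j b' (recolor i b s) (lo i) ==
                  recolor j b' (recolor i b s) (hi i)) = (b' == b) &
    forall b, recolor i b (recolor j c (recolor i c s)) = recolor i b s].
Proof.
move=> ij.
have [[hl ll lh hh]|[lh ll hl hh]] : [/\ lo j = hi i, lo i != lo j, lo i != hi j & hi i != hi j]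
    \/ [/\ hi j = lo i, lo i != lo j, hi i != lo j & hi i != hi j].
  have [E|E] : j = i.+1 :> nat \/ i = j.+1 :> nat by lia.
    by left; split; [apply: val_inj|rewrite -val_eqE /=; lia..].
  by right; split; [apply: val_inj|rewrite -val_eqE /=; lia..].
- exists (s (hi j)); split=> [b|b b'|b].
  + by rewrite hl recolor_hi recolor_other // eq_sym.
  + by rewrite -hl recolor_lo recolor_other // recolor_lo eq_sym.
  + apply/ffunP => k; rewrite !ffunE; case: ifP => // /norP[/negbTE kl /negbTE kh].
    by rewrite hl kl kh /=; case: eqP => [->|].
- exists (s (lo j)); split=> [b|b b'|b].
  + by rewrite lh recolor_lo recolor_other 1?eq_sym.
  + by rewrite -{1}lh recolor_hi recolor_other // recolor_hi.
  + apply/ffunP => k; rewrite !ffunE; case: ifP => // /norP[/negbTE kl /negbTE kh].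
    by rewrite lh kl kh orbF /=; case: eqP => [->|].
Qed.

(** The test at [j] forces the first color to be [c], and the second test at [i] then forces the
    color chosen at [j] to be [c]. Only the last color stays free, as in a single cup-cap: this is
    the straightening of a zigzag. *)
Lemma cupcap_op_near (i j : I) F s : `|i - j|%N = 1%N ->
  cupcap_op i (cupcap_op j (cupcap_op i F)) s = cupcap_op i F s.
Proof.
move=> ij; have [c [condj condi back]] := recolor_near s ij.
rewrite {1 4}/cupcap_op; case: ifP => // _.
rewrite (bigD1 c) //= [X in _ + X]big1 ?addn0 => [|b bc]; last first.
  by rewrite /cupcap_op condj (negbTE bc).
rewrite {1}/cupcap_op condj eqxx.
rewrite (bigD1 c) //= [X in _ + X]big1 ?addn0 => [|b bc]; last first.
  by rewrite /cupcap_op condi (negbTE bc).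
by rewrite /cupcap_op condi eqxx; under eq_bigr do rewrite back.
Qed.

Lemma word_tr_closed_curves (w : seq I) : word_tr w = 2 ^ closed_curves w.
Proof.
rewrite -card_colorings; last exact: closure_edge_sym.
rewrite /word_tr.
under eq_bigr do rewrite -transfer_word_op -sum_paths.
(* [h] uncurries: a sequence of strand colorings, one per level, is a coloring of all points of the
   stack. *)
pose h (g : {ffun 'I_(size w).+1 -> S}) : {ffun 'I_(size w).+1 * 'I_n -> bool} := [ffun u : 'I_(size w).+1 * 'I_n => g u.1 u.2].
pose h' (f : {ffun 'I_(size w).+1 * 'I_n -> bool}) : {ffun 'I_(size w).+1 -> S} :=
  [ffun t => [ffun j => f (t, j)]].
have hK : cancel h h'.
  by move=> g; apply/ffunP => t; apply/ffunP => j; rewrite !ffunE.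
have h'K : cancel h' h by move=> f; apply/ffunP => -[t j]; rewrite !ffunE.
rewrite -sum1dep_card (reindex h) /=; last by exists h' => ? _.
rewrite (exchange_big_dep predT) //= [RHS]big_mkcond /=; apply: eq_bigr => g _.
pose P := [forall t, compatible (tnth (in_tuple w) t) (g (widen_ord (leqnSn _) t)) (g (lift ord0 t))].
rewrite (eq_bigl (fun s => (s == g ord0) && P)) => [|s]; last by rewrite eq_sym.
(* Stack edges amount to compatibility of consecutive levels; closing edges amount to equality of
   the first and last levels, which the diagonal entries of the trace impose. *)
rewrite (_ : [forall u, _] = P && (g ord_max == g ord0)).
  rewrite andbC; case: P; last by rewrite andbF big_pred0 // => s; rewrite andbF.
  by rewrite (big_pred1 (g ord0)) => [|s]; rewrite ?andbT //; case: eqP.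
have bdE t p : boundary (g (widen_ord (leqnSn (size w)) t)) (g (lift ord0 t)) p = h g (level_pt t p).
  by case: p => j; rewrite ffunE.
apply/forallP/andP => [col|[/forallP gP /eqP gE] u].
  have {}col u v : closure_edge (w := w) u v -> h g u = h g v.
    by move=> uv; have /forallP/(_ v)/implyP/(_ uv)/eqP := col u.
  split.
    apply/forallP => t; apply/forallP => p; apply/forallP => q; apply/implyP => pq.
    rewrite !bdE; apply/eqP/col/orP; left.
    apply/existsP; exists t; apply/existsP; exists p; apply/existsP; exists q.
    by rewrite !eqxx.
  apply/eqP/ffunP => j; have := col (ord_max, j) (ord0, j); rewrite !ffunE; apply.
  by rewrite /closure_edge /closing_edge /= !eqxx !orbT.
apply/forallP => v; apply/implyP => /orP[|].
  case/existsP=> t /existsP[p /existsP[q /and3P[/eqP -> /eqP -> pq]]].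
  by have /forallP/(_ p)/forallP/(_ q)/implyP/(_ pq) := gP t; rewrite !bdE.
case: u v => [u1 u2] [v1 v2] /andP[/= /eqP -> /orP[]/andP[/eqP -> /eqP ->]];
  by rewrite !ffunE /= gE.
Qed.

(** Since exponentiation with base 2 is injective, identities between traces become identities
    between numbers of curves, here and in the next lemmas. *)
Lemma closed_curves_catC (w1 w2 : seq I) :
  closed_curves (w1 ++ w2) = closed_curves (w2 ++ w1).
Proof.
apply/eqP; rewrite -(eqn_exp2l _ _ (isT : 1 < 2)) -!word_tr_closed_curves.
exact/eqP/word_tr_catC.
Qed.

Lemma closed_curves_far u (i j : I) v : (2 <= `|i - j|)%N ->
  closed_curves (u ++ [:: i, j & v]) = closed_curves (u ++ [:: j, i & v]).
Proof.
move=> ij; apply/eqP; rewrite -(eqn_exp2l _ _ (isT : 1 < 2)) -!word_tr_closed_curves.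
apply/eqP/(@eq_word_tr u [:: i; j] [:: j; i]) => F s.
exact: cupcap_op_far.
Qed.

Lemma closed_curves_near u (i j : I) v : `|i - j|%N = 1%N ->
  closed_curves (u ++ [:: i, j, i & v]) = closed_curves (u ++ i :: v).
Proof.
move=> ij; apply/eqP; rewrite -(eqn_exp2l _ _ (isT : 1 < 2)) -!word_tr_closed_curves.
apply/eqP/(@eq_word_tr u [:: i; j; i] [:: i]) => F s.
exact: cupcap_op_near.
Qed.

Lemma closed_curves_dup u (i : I) v :
  closed_curves (u ++ [:: i, i & v]) = (closed_curves (u ++ i :: v)).+1.
Proof.
(* Cyclicity brings the repeated letter to the front, where [cupcap_op2] applies to each diagonal
   entry. *)
rewrite closed_curves_catC (closed_curves_catC u (i :: v)) /=.
apply/eqP; rewrite -(eqn_exp2l _ _ (isT : 1 < 2)) expnS -!word_tr_closed_curves.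
rewrite /word_tr big_distrr; apply/eqP/eq_bigr => s _.
exact: cupcap_op2.
Qed.
End Operators.

Local Open Scope ring_scope.

(** * Linear functionals on presented algebras *)

Section QuotientFunctional.
Variables (R : pzRingType) (E : R -> R -> Prop) (S : zmodType).
Variable T : {additive R -> S}.
Hypothesis TE : forall u v, E u v -> forall r r', T (r * u * r') = T (r * v * r').

Lemma ideal_gen_functional0 x : ideal_gen E x -> T x = 0.
Proof.
(* The claim is strengthened to arbitrary factors on both sides, so that the induction passes
   through multiplication by ring elements. *)
move=> Ex; suff T0 r r' : T (r * x * r') = 0.
  by have := T0 1 1; rewrite mul1r mulr1.
elim: Ex r r' => {x} [u v uv||u v _ IHu _ IHv|s u _ IH|s u _ IH] r r'.
- by rewrite mulrBr mulrBl raddfB /= (TE uv) subrr.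
- by rewrite mulr0 mul0r raddf0.
- by rewrite mulrDr mulrDl raddfD /= IHu IHv addr0.
- by rewrite mulrA.
- by rewrite !mulrA -(mulrA _ s).
Qed.

(** This makes [T] descend to the quotient as its value on chosen representatives. *)
Lemma functional_repr u : T (repr (rquot_pi E u)) = T u.
Proof.
apply/eqP; rewrite -subr_eq0 -raddfB; apply/eqP.
exact/ideal_gen_functional0/repr_rquot.
Qed.
End QuotientFunctional.

(* A is kept abstract because on free_alg itself unification unfolds the
   product of the monoid algebra. *)
Section SpannedAlgebra.
Variables (k : pzRingType) (A : algType k) (S : comPzRingType) (f : k -> S).
Variables (T : {additive A -> S}) (W : Type) (b : W -> A).
Hypothesis TZ : forall c u, T (c *: u) = f c * T u.
Hypothesis A_ind : forall P : A -> Prop,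
    P 0 -> (forall u v, P u -> P v -> P (u + v)) ->
    (forall c w, P (c *: b w)) ->
  forall u, P u.

(** Both sides are additive and semilinear in [r] and in [r'], so a relation need only be tested
    between members of the spanning family. *)
Lemma eq_functional_sandwich u v :
    (forall m m', T (b m * u * b m') = T (b m * v * b m')) ->
  forall r r', T (r * u * r') = T (r * v * r').
Proof.
move=> uv r r'; elim/A_ind: r r' => [r'|r s IHr IHs r'|c m r'].
- by rewrite !mul0r.
- by rewrite !mulrDl !raddfD /= IHr IHs.
elim/A_ind: r' => [|r s IHr IHs|c' m'].
- by rewrite !mulr0.
- by rewrite !mulrDr !raddfD /= IHr IHs.
by rewrite -!scalerAr -!scalerAl !TZ uv.
Qed.

Lemma functionalC : (forall m m', T (b m * b m') = T (b m' * b m)) ->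
  forall u v, T (u * v) = T (v * u).
Proof.
move=> bC u v; elim/A_ind: u v => [v|r s IHr IHs v|c m v].
- by rewrite mul0r mulr0.
- by rewrite mulrDl mulrDr !raddfD /= IHr IHs.
elim/A_ind: v => [|r s IHr IHs|c' m'].
- by rewrite mul0r mulr0.
- by rewrite mulrDl mulrDr !raddfD /= IHr IHs.
by rewrite -!scalerAr -!scalerAl !TZ bC mulrCA.
Qed.
End SpannedAlgebra.

Section FreeFunctional.
Variables (k : comNzRingType) (G : choiceType) (S : comNzRingType).

Definition free_word (w : seq G) : free_alg k G := \prod_(g <- w) free_gen k g.

Lemma free_wordE w : free_word w = << FMonom w >>.
Proof.
rewrite /free_word; elim: w => [|g w IH]; first by rewrite big_nil -fmoneE.
rewrite big_cons IH free_gen.unlock; apply: etrans (malgM_def _ _) _.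
by rewrite fgmulUU mulr1; congr << _ >>; apply: val_inj; rewrite /= fmM fmU.
Qed.

Lemma free_word_cat w w' : free_word (w ++ w') = free_word w * free_word w'.
Proof. exact: big_cat. Qed.

Lemma free_gen_word g : free_gen k g = free_word [:: g].
Proof. by rewrite /free_word big_seq1. Qed.

Lemma free_span (u : free_alg k G) :
  u = \sum_(m <- msupp u) u@_m *: free_word m.
Proof.
rewrite {1}[u]monalgE; apply: eq_bigr => m _; rewrite free_wordE.
by apply/malgP => m'; rewrite [RHS]mcoeffZ !mcoeffU mulr_natr fmK.
Qed.

Lemma free_alg_ind (P : free_alg k G -> Prop) :
    P 0 -> (forall u v, P u -> P v -> P (u + v)) ->
    (forall c w, P (c *: free_word w)) ->
  forall u, P u.
Proof.
by move=> P0 PD PZ u; rewrite [u]free_span; apply: big_ind => // m _.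
Qed.

Variables (f : {rmorphism k -> S}) (phi : seq G -> S).

(** Here [phi] is an arbitrary function on words, so [mmap] gives its [f]-semilinear extension from
    the basis of words, in general not a ring morphism. *)
Definition free_functional : free_alg k G -> S :=
  mmap f (fun m : {fmonom G} => phi m).

Lemma free_functional_is_zmod_morphism : zmod_morphism free_functional.
Proof. exact: raddfB. Qed.
HB.instance Definition _ := GRing.isZmodMorphism.Build (free_alg k G) S
  free_functional free_functional_is_zmod_morphism.

Lemma free_functionalZ c u : free_functional (c *: u) = f c * free_functional u.
Proof.
rewrite /free_functional (mmapEw (msuppZ_le c u)) mmapE mulr_sumr.
by apply: eq_bigr => m _; rewrite mcoeffZ /= rmorphM mulrA.
Qed.

Lemma free_functional_word w : free_functional (free_word w) = phi w.
Proof. by rewrite free_wordE [LHS]mmapU /= rmorph1 mul1r. Qed.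

Lemma eq_free_functional_sandwich u v :
    (forall m m', free_functional (free_word m * u * free_word m')
                = free_functional (free_word m * v * free_word m')) ->
  forall r r', free_functional (r * u * r') = free_functional (r * v * r').
Proof.
exact: (eq_functional_sandwich free_functionalZ free_alg_ind).
Qed.

Lemma free_functionalC : (forall m m', phi (m ++ m') = phi (m' ++ m)) ->
  forall u v, free_functional (u * v) = free_functional (v * u).
Proof.
move=> phiC; apply: (functionalC free_functionalZ free_alg_ind) => m m'.
by rewrite -!free_word_cat [LHS]free_functional_word [RHS]free_functional_word.
Qed.
End FreeFunctional.

Section TensFunctional.
Variables (k k' : comNzRingType) (f : {rmorphism k -> k'}) (B : algType k).
Variable tau : {additive B -> k'}.
Hypothesis tauZ : forall r b, tau (r *: b) = f r * tau b.
Hypothesis tauC : forall b b', tau (b * b') = tau (b' * b).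

(** A word of pairs stands for a product of pure tensors; this is the functional sending b ⊗ c to c
    [tau] b, evaluated on that product. *)
Definition tens_word_val (w : seq (B * k')%type) : k' :=
  (\prod_(p <- w) p.2) * tau (\prod_(p <- w) p.1).

Definition tens_free_functional : {additive tens_free k' B -> k'} :=
  free_functional idfun tens_word_val.

(** The middle word is arbitrary because the relations involve products of zero, one and two pure
    tensors. *)
Lemma tens_free_functional_sandwich m m' u :
  tens_free_functional (free_word k' m * free_word k' u * free_word k' m')
  = ((\prod_(p <- m) p.2) * (\prod_(p <- m') p.2)) * (\prod_(p <- u) p.2)
    * tau ((\prod_(p <- m) p.1) * (\prod_(p <- u) p.1) * (\prod_(p <- m') p.1)).
Proof.
rewrite -!free_word_cat [LHS]free_functional_word /tens_word_val !big_cat /=.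
by congr (_ * _); rewrite mulrAC.
Qed.

Lemma tens_free_functional_rel u v : tens_rel f u v -> forall r r',
  tens_free_functional (r * u * r') = tens_free_functional (r * v * r').
Proof.
move=> uv; apply: eq_free_functional_sandwich => m m'.
have TD a x y b : tens_free_functional (a * (x + y) * b)
    = tens_free_functional (a * x * b) + tens_free_functional (a * y * b).
  by rewrite -raddfD -mulrDl -mulrDr.
have TZ c a x b : tens_free_functional (a * (c *: x) * b)
    = c * tens_free_functional (a * x * b).
  by rewrite -scalerAr -scalerAl; apply: free_functionalZ.
have T1 b c : tens_free_functional (free_word k' m * pure_free b c * free_word k' m')
    = ((\prod_(p <- m) p.2) * (\prod_(p <- m') p.2)) * c
      * tau ((\prod_(p <- m) p.1) * b * (\prod_(p <- m') p.1)).
  have /= := tens_free_functional_sandwich m m' [:: (b, c)].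
  by rewrite !big_seq1 -free_gen_word.
case: {u v} uv => [b b' c|b c c'|r b c|r b c||b b' c c'].
- rewrite [RHS]TD [X in _ = X + _]T1 [X in _ = _ + X]T1 [LHS]T1.
  by rewrite mulrDr mulrDl raddfD mulrDr.
- rewrite [RHS]TD [X in _ = X + _]T1 [X in _ = _ + X]T1 [LHS]T1.
  by rewrite mulrDr mulrDl.
- rewrite [LHS]T1 [RHS]T1 -scalerAr -scalerAl tauZ; ring.
- rewrite [LHS]TZ [X in _ * X = _]T1 [RHS]T1; ring.
- rewrite [RHS]T1.
  have /= := tens_free_functional_sandwich m m' [::].
  by rewrite !big_nil /free_word big_nil.
- rewrite [RHS]T1.
  have /= := tens_free_functional_sandwich m m' [:: (b, c); (b', c')].
  by rewrite !big_cons !big_nil !mulr1 /free_word !big_cons big_nil mulr1.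
Qed.

Definition tens_functional (q : tens f B) : k' := tens_free_functional (repr q).

Lemma tens_functionalE u :
  tens_functional (rquot_pi _ u) = tens_free_functional u.
Proof. exact/functional_repr/tens_free_functional_rel. Qed.

Lemma tens_functional_is_zmod_morphism : zmod_morphism tens_functional.
Proof.
elim/rquot_ind=> u; elim/rquot_ind=> v.
by rewrite -rmorphB !tens_functionalE raddfB.
Qed.

Lemma tens_functionalZ c q : tens_functional (c *: q) = c * tens_functional q.
Proof.
elim/rquot_ind: q => u; rewrite -rquot_piZ !tens_functionalE.
exact: free_functionalZ.
Qed.

Lemma tens_functionalC p q : tens_functional (p * q) = tens_functional (q * p).
Proof.
elim/rquot_ind: p => u; elim/rquot_ind: q => v.
have TM x y : tens_functional (rquot_pi _ x * rquot_pi _ y)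
    = tens_free_functional (x * y).
  by rewrite -rmorphM; apply: tens_functionalE.
rewrite [LHS]TM [RHS]TM; apply: free_functionalC => m m'.
rewrite /tens_word_val !big_cat /= tauC; congr (_ * _); exact: mulrC.
Qed.

Lemma tens_functional_prod (I : Type) (s : seq I) (b : I -> B) :
  tens_functional (\prod_(i <- s) pure f (b i) 1) = tau (\prod_(i <- s) b i).
Proof.
rewrite -rmorph_prod tens_functionalE.
have -> : \prod_(i <- s) pure_free (b i) 1 = free_word k' [seq (b i, 1) | i <- s].
  by rewrite /free_word big_map.
rewrite [LHS]free_functional_word /tens_word_val !big_map /=.
by rewrite big1_eq mul1r.
Qed.
End TensFunctional.

(** * The trace *)

Lemma A_to_A1_x : A_to_A1 xA = aA1.
Proof.
apply/eqP; rewrite -subr_eq0 -rmorphB; apply/eqP.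
exact: etrans (rquot_rel A1_rel_xa) (rmorph0 _).
Qed.

Lemma sqr_aA1 : aA1 * aA1 = 1.
Proof. by rewrite -expr2 -rmorphXn sqrAa rmorph1. Qed.

Lemma A_to_A1_xV : A_to_A1 xVA = aA1.
Proof.
have: A_to_A1 (xA * xVA) = 1 by rewrite mulAxV rmorph1.
by rewrite rmorphM A_to_A1_x => /(congr1 ( *%R aA1)); rewrite mulrA sqr_aA1 mul1r mulr1.
Qed.

(** At x = a, the relation a^2 = 1 gives [delta] = 1 and x^-1 = a. *)
Lemma A_to_A1_delta_xV : A_to_A1 (delta * xVA) = aA1.
Proof.
rewrite rmorphM rmorphB rmorphM A_to_A1_x A_to_A1_xV sqr_aA1 rmorph_nat.
by rewrite mulrBl mul1r mulr2n mulrDl mul1r addrK.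
Qed.

(** The factor a - x vanishes, so C^2 = 0 after specialization, which agrees with the value 0 given
    to words with two or more C. *)
Lemma A_to_A1_C_sqr : A_to_A1 (2 * xVA ^+ 2 * delta * (aA - xA)) = 0.
Proof. by rewrite rmorphM [X in _ * X]rmorphB A_to_A1_x subrr mulr0. Qed.

Lemma A_to_A1_near : A_to_A1 (2 * aA * xVA) = 2.
Proof. by rewrite !rmorphM A_to_A1_xV -mulrA sqr_aA1 mulr1 rmorph_nat. Qed.

Section TraceValue.
Variables (R : comNzRingType) (a : R) (n : nat).
Hypothesis a_sqr : a * a = 1.
Local Notation I := 'I_n.-1.
Implicit Types (c : nat) (i j : I) (u v w : seq I).

(* c counts the letters C of a word, and w lists its letters e_i; a word with
   n strands and no C has the value prescribed by the theorem. *)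
Definition trace_val c w : R :=
  match c with
  | 0 => a ^+ (size w + n) * ((closed_curves w)%:R - (size w)%:R)
  | 1 => - a ^+ (size w + n.+1)
  | _ => 0
  end.

Lemma trace_val_catC c u v : trace_val c (u ++ v) = trace_val c (v ++ u).
Proof. by rewrite /trace_val closed_curves_catC !size_cat (addnC (size u)). Qed.

(** Without C, the extra letter also creates one extra closed curve, so N - k is unchanged and only
    the power of [a] moves. *)
Lemma trace_val_dup c u i v :
  trace_val c (u ++ [:: i, i & v]) = a * trace_val c (u ++ i :: v).
Proof.
case: c => [|[|c]] /=; last by rewrite mulr0.
  rewrite closed_curves_dup !size_cat /= !addnS !addSn !exprS -!natr1; ring.
by rewrite !size_cat /= !addnS !addSn !exprS mulrN.
Qed.

Lemma trace_val_eC c u i v :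
  trace_val c.+1 (u ++ i :: v) = a * trace_val c.+1 (u ++ v).
Proof.
case: c => [|c] /=; last by rewrite mulr0.
by rewrite !size_cat /= !addnS !addSn !exprS mulrN.
Qed.

Lemma trace_val_far c u i j v : (2 <= `|i - j|)%N ->
  trace_val c (u ++ [:: i, j & v]) = trace_val c (u ++ [:: j, i & v]).
Proof.
by move=> ij; rewrite /trace_val (closed_curves_far _ _ ij) !size_cat.
Qed.

(** Without C, both words have the same N but lengths k and k - 2, so the values differ by -2 a^(k +
    n). As a^2 = 1, this is twice the value of the word with C. If C is already present, the
    correction has two C and vanishes. *)
Lemma trace_val_near c u i j v : `|i - j|%N = 1%N ->
  trace_val c (u ++ [:: i, j, i & v])
  = trace_val c (u ++ i :: v) + 2 * trace_val c.+1 (u ++ v).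
Proof.
move=> ij; case: c => [|[|c]] /=; last by rewrite mulr0 addr0.
  rewrite (closed_curves_near _ _ ij) !size_cat /= !addnS !addSn !exprS -!natr1.
  by rewrite [a * (a * _)]mulrA a_sqr mul1r; ring.
rewrite !size_cat /= !addnS !addSn !exprS mulr0 addr0.
by congr (- _); rewrite [LHS]mulrA a_sqr mul1r.
Qed.
End TraceValue.

Section TLFunctional.
Variable n : nat.
Local Notation I := 'I_n.-1.

(** The positions of C are forgotten, so e_i C and C e_i get the same value and [trace_val_eC]
    serves both relations. *)
Definition TL_word_val (w : seq (option I)) : ringA1 :=
  trace_val aA1 (count_mem None w) (pmap id w).

Definition TL_free_functional : {additive TL_free n -> ringA1} :=
  free_functional A_to_A1 TL_word_val.

Local Notation word := (free_word ringA).

(** The count of the middle word stands first, so that for a concrete [u] it computes to explicit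
    successors and selects the case of [trace_val]. *)
Lemma TL_free_functional_sandwich m m' (u : seq (option I)) :
  TL_free_functional (word m * word u * word m')
  = trace_val aA1 (count_mem None u + (count_mem None m + count_mem None m'))
      (pmap id m ++ pmap id u ++ pmap id m').
Proof.
rewrite -!free_word_cat [LHS]free_functional_word /TL_word_val.
by rewrite !count_cat !pmap_cat -catA addnAC addnC.
Qed.

Lemma TL_free_functional_rel u v : TL_rel u v -> forall r r',
  TL_free_functional (r * u * r') = TL_free_functional (r * v * r').
Proof.
move=> uv; apply: eq_free_functional_sandwich => m m'.
have TD a x y b : TL_free_functional (a * (x + y) * b)
    = TL_free_functional (a * x * b) + TL_free_functional (a * y * b).
  by rewrite -raddfD -mulrDl -mulrDr.
have TZ c a x b : TL_free_functional (a * (c *: x) * b)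
    = A_to_A1 c * TL_free_functional (a * x * b).
  by rewrite -scalerAr -scalerAl; apply: free_functionalZ.
have eE i : free_e i = word [:: Some i] by exact: free_gen_word.
have CE : free_C n = word [:: None] by exact: free_gen_word.
have T := TL_free_functional_sandwich m m'.
case: {u v} uv => [i|i|i||i j ij|i j ij].
- rewrite [RHS]TZ A_to_A1_delta_xV expr2 eE -free_word_cat [LHS]T [X in _ = _ * X]T.
  exact: trace_val_dup.
- rewrite [RHS]TZ A_to_A1_delta_xV eE CE -free_word_cat [LHS]T [X in _ = _ * X]T.
  exact: trace_val_eC.
- rewrite [RHS]TZ A_to_A1_delta_xV eE CE -free_word_cat [LHS]T [X in _ = _ * X]T.
  exact: trace_val_eC.
- by rewrite [RHS]TZ A_to_A1_C_sqr mul0r expr2 CE -free_word_cat [LHS]T.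
- rewrite !eE -(free_word_cat _ [:: Some i] [:: Some j]).
  rewrite -(free_word_cat _ [:: Some j] [:: Some i]) [LHS]T [RHS]T.
  exact: trace_val_far.
- rewrite [RHS]TD [X in _ = _ + X]TZ A_to_A1_near !eE CE.
  rewrite -(free_word_cat _ [:: Some i] [:: Some j]).
  rewrite -(free_word_cat _ [:: Some i; Some j] [:: Some i]).
  rewrite [LHS]T [X in _ = X + _]T [X in _ = _ + _ * X]T.
  exact: trace_val_near sqr_aA1 _ _ _ _ _ ij.
Qed.

Definition TLt_functional (q : TLt n) : ringA1 := TL_free_functional (repr q).

Lemma TLt_functionalE u : TLt_functional (rquot_pi _ u) = TL_free_functional u.
Proof. exact/functional_repr/TL_free_functional_rel. Qed.

Lemma TLt_functional_is_zmod_morphism : zmod_morphism TLt_functional.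
Proof.
elim/rquot_ind=> u; elim/rquot_ind=> v.
by rewrite -rmorphB !TLt_functionalE raddfB.
Qed.
HB.instance Definition _ := GRing.isZmodMorphism.Build (TLt n) ringA1
  TLt_functional TLt_functional_is_zmod_morphism.

Lemma TLt_functionalZ c q :
  TLt_functional (c *: q) = A_to_A1 c * TLt_functional q.
Proof.
elim/rquot_ind: q => u; rewrite -rquot_piZ !TLt_functionalE.
exact: free_functionalZ.
Qed.

Lemma TLt_functionalC p q : TLt_functional (p * q) = TLt_functional (q * p).
Proof.
elim/rquot_ind: p => u; elim/rquot_ind: q => v.
have TM x y : TLt_functional (rquot_pi _ x * rquot_pi _ y)
    = TL_free_functional (x * y).
  by rewrite -rmorphM; apply: TLt_functionalE.
rewrite [LHS]TM [RHS]TM; apply: free_functionalC => m m'.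
by rewrite /TL_word_val !count_cat !pmap_cat trace_val_catC addnC.
Qed.

Lemma TLt_functional_C : TLt_functional (TLt_C n) = - aA1 ^+ n.+1.
Proof.
rewrite [LHS]TLt_functionalE (_ : free_C n = word [:: None]); last exact: free_gen_word.
by rewrite [LHS]free_functional_word.
Qed.

Lemma TLt_functional_prod_e (w : seq I) :
  TLt_functional (\prod_(i <- w) TLt_e i) = trace_val aA1 0 w.
Proof.
rewrite -rmorph_prod [LHS]TLt_functionalE.
have -> : \prod_(i <- w) free_e i = word (map Some w).
  by rewrite /free_word big_map.
rewrite [LHS]free_functional_word /TL_word_val count_map.
by rewrite (eq_count (a2 := pred0)) // count_pred0 map_pK.
Qed.

Definition TLt1_trace : TLt1 n -> ringA1 :=
  tens_functional (f := A_to_A1) TLt_functional.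

Lemma TLt1_trace_is_zmod_morphism : zmod_morphism TLt1_trace.
Proof. exact/tens_functional_is_zmod_morphism/TLt_functionalZ. Qed.
HB.instance Definition _ := GRing.isZmodMorphism.Build (TLt1 n) ringA1
  TLt1_trace TLt1_trace_is_zmod_morphism.

Lemma TLt1_trace_is_scalable : scalable_for *%R TLt1_trace.
Proof. by move=> c q; apply/tens_functionalZ/TLt_functionalZ. Qed.
HB.instance Definition _ := GRing.isScalable.Build ringA1 (TLt1 n) ringA1 *%R
  TLt1_trace TLt1_trace_is_scalable.
End TLFunctional.

Theorem proposition6p16 :
  exists t : forall n : nat, {linear TLt1 n -> ringA1 | *%R},
    forall n : nat, (0 < n)%N ->
      [/\ forall u v : TLt1 n, t n (u * v) = t n (v * u),
          t n (TLt1_C n) = - aA1 ^+ n.+1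
        & forall w : seq 'I_n.-1,
            t n (\prod_(i <- w) TLt1_e i)
            = aA1 ^+ (size w + n) * ((closed_curves w)%:R - (size w)%:R)].
Proof.
exists (fun n => @TLt1_trace n : {linear TLt1 n -> ringA1 | *%R}) => n _; split.
- exact: tens_functionalC (@TLt_functionalZ n) (@TLt_functionalC n).
- apply: etrans _ (TLt_functional_C n).
  (* C is treated as a product with one factor, indexed by a one-element list. *)
  have := tens_functional_prod (@TLt_functionalZ n) [:: tt] (fun=> TLt_C n).
  by rewrite !big_seq1.
- move=> w; apply: etrans (tens_functional_prod (@TLt_functionalZ n) w _) _.
  exact: TLt_functional_prod_e.
Qed.
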